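(* Let $d\ge 1$, let $U\subset\mathbb{R}^{d}$ be open and convex, let $f\in C^{1}(U;\mathbb{R}^{d})$ with Jacobian $J_f$, let $x_n\in U$, and let $M(x_n)\in\mathbb{R}^{d\times d}$ be an invertible matrix. Put $\alpha_n:=\|M(x_n)^{-1}f(x_n)\|$. Assume that there are constants $\omega^{\star}>0$ and $\kappa^{\star}<1$ such that: (A$^\star$1) for all $x,v\in U$ and every $t\in[0,1]$, with $z:=t x+(1-t)v$, $$\|M(x_n)^{-1}(J_f(x)-J_f(z))(x-v)\|\le \omega^{\star}(1-t)\|x-v\|^{2};$$ (A$^\star$2) for every $x\in U$, $\|\mathrm{Id}-M(x_n)^{-1}J_f(x)\|\le\kappa^{\star}<1$; (A$^\star$3) $\alpha_n>0$ and $\omega^{\star}\alpha_n\le \frac{(1-\kappa^{\star})^2}{2}$; (A$^\star$4) for $$R^{\star}:=\frac{1-\kappa^{\star}}{\omega^{\star}}+\sqrt{\frac{(1-\kappa^{\star})^2}{(\omega^{\star})^2}-\frac{2\alpha_n}{\omega^{\star}}}$$ one has $B_{R^{\star}}(x_n)\subset U$. Then the map $g:U\to\mathbb{R}^{d}$, $g(v):=v-M(x_n)^{-1}f(v)$, satisfies $g(B_{R^{\star}}(x_n))\subset B_{R^{\star}}(x_n)$ and is a contraction on $B_{R^{\star}}(x_n)$.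
   Context: $\|x\|$ is the Euclidean norm on $\mathbb{R}^d$, and for a matrix $M$, $\|M\|:=\sup_{\|x\|=1}\|Mx\|$ is the operator norm. $B_R(x)$ denotes the closed ball of radius $R$ centered at $x$. $\mathrm{Id}$ is the identity matrix. A contraction on a set $B$ is a map $g$ for which there is $L<1$ with $\|g(x)-g(y)\|\le L\|x-y\|$ for all $x,y\in B$. The subscript $n$ in $x_n$ is only an index (in the source, $x_n$ is an iterate of the damped scheme $x_{j+1}=x_j-t_jM(x_j)^{-1}f(x_j)$, $t_j\in(0,1]$, started at some $x_0\in U$, where $x\mapsto M(x)$ is a matrix-valued map on $U$); the dimension is denoted $d$. *)

(* Defs.v *)
From HB Require Import structures.
From mathcomp Require Import all_boot all_order all_algebra.
From mathcomp Require Import all_classical all_reals all_analysis.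
Import Order.TTheory GRing.Theory Num.Theory.
Import numFieldNormedType.Exports.

Set Implicit Arguments.
Unset Strict Implicit.
Unset Printing Implicit Defensive.

Local Open Scope classical_set_scope.
Local Open Scope ring_scope.

(* The library norm [`|x|] on matrices is the sup norm, so the Euclidean norm
   and the notions depending on it are defined here.  Both norms induce the
   same topology: openness, continuity and differentiability are the
   library's. *)
Definition enorm (R : realType) (d : nat) (x : 'cV[R]_d) : R :=
  Num.sqrt (\sum_(i < d) x i 0 ^+ 2).

(* Meaningful for 0 < d only: [sup set0 = 0]. *)
Definition opnorm (R : realType) (d : nat) (A : 'M[R]_d) : R :=
  sup [set enorm (A *m x) | x in [set x : 'cV[R]_d | enorm x = 1]].

Definition eball (R : realType) (d : nat) (x : 'cV[R]_d) (r : R) :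
    set 'cV[R]_d :=
  [set y | enorm (y - x) <= r].

(* [delta_mx j 0] is the j-th vector of the canonical basis.  The library
   Jacobian ['J f x] acts on row vectors, whence the transposed convention. *)
Definition Jac (R : realType) (d : nat) (f : 'cV[R]_d -> 'cV[R]_d)
    (x : 'cV[R]_d) : 'M[R]_d :=
  \matrix_(i, j) 'D_(delta_mx j 0) (fun y : 'cV[R]_d => f y i 0) x.

(* For open U; the values of f outside U are irrelevant. *)
Definition C1_on (R : realType) (d : nat) (U : set 'cV[R]_d)
    (f : 'cV[R]_d -> 'cV[R]_d) : Prop :=
  {in U, forall x, differentiable f x} /\ {in U, continuous (Jac f)}.

Definition econtraction_on (R : realType) (d : nat) (B : set 'cV[R]_d)
    (g : 'cV[R]_d -> 'cV[R]_d) : Prop :=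
  exists2 L : R, L < 1 &
    {in B &, forall x y, enorm (g x - g y) <= L * enorm (x - y)}.

(* Main.v *)
(* By (A*2) the derivative of g has operator norm at most kappa on the convex
   set U, so the mean value inequality makes g kappa-Lipschitz there.  The
   radius is a root of the quadratic
     alpha + omega / 2 * Rstar ^ 2 = (1 - kappa) * Rstar,
   hence alpha + kappa * Rstar <= Rstar, and since g moves xn by exactly
   alpha, the ball is mapped into itself. *)
Require Import Defs.
From HB Require Import structures.
From mathcomp Require Import all_boot all_order all_algebra.
From mathcomp Require Import all_classical all_reals all_analysis.
From mathcomp Require Import ring lra.
Import Order.TTheory GRing.Theory Num.Theory.
Import numFieldNormedType.Exports.

Local Open Scope classical_set_scope.
Local Open Scope ring_scope.

Set Implicit Arguments.
Unset Strict Implicit.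

Definition edot (R : realType) (d : nat) (x y : 'cV[R]_d) : R :=
  \sum_(i < d) x i 0 * y i 0.

Lemma sum_sqr_ge0 (R : realType) (d : nat) (x : 'cV[R]_d) :
  0 <= \sum_(i < d) x i 0 ^+ 2.
Proof. by apply: sumr_ge0 => i _; exact: sqr_ge0. Qed.

Lemma enorm_ge0 (R : realType) (d : nat) (x : 'cV[R]_d) : 0 <= enorm x.
Proof. exact: sqrtr_ge0. Qed.

Lemma enorm_sqr (R : realType) (d : nat) (x : 'cV[R]_d) :
  enorm x ^+ 2 = \sum_(i < d) x i 0 ^+ 2.
Proof. by rewrite sqr_sqrtr// sum_sqr_ge0. Qed.

Lemma enorm_sqr_edot (R : realType) (d : nat) (x : 'cV[R]_d) :
  enorm x ^+ 2 = edot x x.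
Proof. by rewrite enorm_sqr; apply: eq_bigr => i _; rewrite expr2. Qed.

Lemma enorm_eq0 (R : realType) (d : nat) (x : 'cV[R]_d) :
  enorm x = 0 -> x = 0.
Proof.
move=> x0; have : \sum_(i < d) x i 0 ^+ 2 = 0.
  by rewrite -enorm_sqr x0 expr0n.
move/psumr_eq0P => /(_ (fun i _ => sqr_ge0 _)) xi0.
by apply/colP => i; rewrite mxE; apply/eqP; rewrite -sqrf_eq0 xi0.
Qed.

Lemma enorm0 (R : realType) (d : nat) : enorm (0 : 'cV[R]_d) = 0.
Proof.
by rewrite /enorm big1 ?sqrtr0// => i _; rewrite mxE expr0n.
Qed.

Lemma enormZ (R : realType) (d : nat) (a : R) (x : 'cV[R]_d) :
  enorm (a *: x) = `|a| * enorm x.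
Proof.
rewrite /enorm -sqrtr_sqr -sqrtrM ?sqr_ge0// mulr_sumr.
by congr Num.sqrt; apply: eq_bigr => i _; rewrite mxE exprMn.
Qed.

(** Cauchy-Schwarz: after multiplication by [enorm y ^+ 2], the gap between the two sides is the
    squared norm of [enorm y ^+ 2 *: x - edot x y *: y]. The factor can be cancelled only if it is
    nonzero, whence the separate case [enorm y = 0]. *)
Lemma edot_sqr_le (R : realType) (d : nat) (x y : 'cV[R]_d) :
  edot x y ^+ 2 <= enorm x ^+ 2 * enorm y ^+ 2.
Proof.
have [y0|y0] := eqVneq (enorm y) 0.
  have -> : edot x y = 0.
    by rewrite (enorm_eq0 y0); apply: big1 => i _; rewrite mxE mulr0.
  by rewrite y0 !expr0n mulr0.
have Y0 : 0 < enorm y ^+ 2 by rewrite lt_def sqrf_eq0 y0 sqr_ge0.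
rewrite -(ler_pM2l Y0) -subr_ge0.
have expand (a s : R) : \sum_(i < d) (a * x i 0 - s * y i 0) ^+ 2 =
    a ^+ 2 * enorm x ^+ 2 - 2 * a * s * edot x y + s ^+ 2 * enorm y ^+ 2.
  rewrite !enorm_sqr /edot !mulr_sumr -sumrB -big_split/=.
  by apply: eq_bigr => i _; ring.
have -> : enorm y ^+ 2 * (enorm x ^+ 2 * enorm y ^+ 2)
    - enorm y ^+ 2 * edot x y ^+ 2
  = \sum_(i < d) (enorm y ^+ 2 * x i 0 - edot x y * y i 0) ^+ 2.
  by rewrite expand; ring.
by apply: sumr_ge0 => i _; exact: sqr_ge0.
Qed.

Lemma edot_le (R : realType) (d : nat) (x y : 'cV[R]_d) :
  edot x y <= enorm x * enorm y.
Proof.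
rewrite (le_trans (ler_norm _))// -ler_sqr ?nnegrE ?mulr_ge0 ?enorm_ge0//.
by rewrite real_normK ?num_real// exprMn edot_sqr_le.
Qed.

Lemma enormD (R : realType) (d : nat) (x y : 'cV[R]_d) :
  enorm (x + y) <= enorm x + enorm y.
Proof.
rewrite -ler_sqr ?nnegrE ?addr_ge0 ?enorm_ge0//.
have -> : enorm (x + y) ^+ 2 = enorm x ^+ 2 + 2 * edot x y + enorm y ^+ 2.
  rewrite !enorm_sqr /edot mulr_sumr -!big_split/=.
  by apply: eq_bigr => i _; rewrite !mxE; ring.
by have := edot_le x y; nra.
Qed.

(** The constant is the Frobenius norm, by Cauchy-Schwarz on each row. It serves to show that the
    set whose supremum is [opnorm A] is bounded above. *)
Lemma enorm_mulmx_bounded (R : realType) (d : nat) (A : 'M[R]_d) :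
  exists C : R, forall x : 'cV[R]_d, enorm (A *m x) <= C * enorm x.
Proof.
pose C : R := \sum_(i < d) enorm (row i A)^T ^+ 2.
have C0 : 0 <= C by apply: sumr_ge0 => i _; exact: sqr_ge0.
exists (Num.sqrt C) => x.
rewrite -ler_sqr ?nnegrE ?mulr_ge0 ?enorm_ge0 ?sqrtr_ge0//.
rewrite exprMn (sqr_sqrtr C0) [leLHS]enorm_sqr mulr_suml.
apply: ler_sum => i _; apply: le_trans (edot_sqr_le _ _).
by rewrite mxE /edot; under [in leRHS]eq_bigr do rewrite !mxE.
Qed.

Lemma enorm_mulmx_le (R : realType) (d : nat) (A : 'M[R]_d) (x : 'cV[R]_d) :
  enorm (A *m x) <= opnorm A * enorm x.
Proof.
have [x0|x0] := eqVneq (enorm x) 0.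
  by rewrite x0 mulr0 (enorm_eq0 x0) mulmx0 enorm0.
have x_gt0 : 0 < enorm x by rewrite lt_def x0 enorm_ge0.
have [C AC] := enorm_mulmx_bounded A.
rewrite -ler_pdivrMr//.
have -> : enorm (A *m x) / enorm x = enorm (A *m ((enorm x)^-1 *: x)).
  by rewrite -scalemxAr enormZ ger0_norm ?invr_ge0 ?enorm_ge0// mulrC.
apply: ub_le_sup; last first.
  exists ((enorm x)^-1 *: x) => //=.
  by rewrite enormZ ger0_norm ?invr_ge0 ?enorm_ge0// mulVf.
by exists C => _ [y /= y1 <-]; rewrite (le_trans (AC y))// y1 mulr1.
Qed.

(** Without a unit vector, as in dimension 0, the supremum is over the empty set and equals 0 by
    convention. *)
Lemma opnorm_ge0 (R : realType) (d : nat) (A : 'M[R]_d) : 0 <= opnorm A.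
Proof.
have [[x x1]|no_unit] := pselect (exists x : 'cV[R]_d, enorm x = 1).
  have := enorm_mulmx_le A x; rewrite x1 mulr1.
  by apply: le_trans; exact: enorm_ge0.
rewrite /opnorm (_ : [set _ | _ in _] = set0) ?sup0//.
by apply/seteqP; split=> // _ [x /= x1 _]; apply: no_unit; exists x.
Qed.

(** The differential is linear, so expanding [v] in the canonical basis turns the derivative along
    [v] into a combination of the partial derivatives stored in [Jac f x]. *)
Lemma is_derive_coord_Jac (R : realType) (d : nat)
    (f : 'cV[R]_d -> 'cV[R]_d) (x v : 'cV[R]_d) (i : 'I_d) :
  differentiable f x ->
  is_derive x v (fun y => f y i 0) ((Jac f x *m v) i 0).
Proof.
move=> df.
have dfi : differentiable (fun y => f y i 0) x.
  exact: (differentiable_comp df (differentiable_coord (f x) i 0)).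
apply: DeriveDef; first exact: diff_derivable.
rewrite deriveE// [in LHS](matrix_sum_delta v) !linear_sum/= mxE.
apply: eq_bigr => j _; rewrite big_ord1 linearZ/= mxE deriveE//.
by rewrite mulrC.
Qed.

(** The two difference quotients are the same function of the increment, so no chain rule is
    involved. *)
Lemma is_derive_line (R : realType) (V : normedModType R) (h : V -> R)
    (y v : V) (t dh : R) :
  is_derive (y + t *: v) v h dh ->
  is_derive t 1 (fun s : R => h (y + s *: v)) dh.
Proof.
have eqq : (fun k : R => k^-1 *: (((fun s : R => h (y + s *: v)) \o shift t)
     (k *: 1) - h (y + t *: v))) =
   (fun k : R => k^-1 *: ((h \o shift (y + t *: v)) (k *: v)
     - h (y + t *: v))).
  apply/funext => k /=; congr (_ *: (h _ - _)).
  by rewrite [k *: 1]mulr1 scalerDl addrCA.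
move=> [dx dE]; apply: DeriveDef.
  by rewrite /derivable eqq.
by rewrite -dE /derive eqq.
Qed.

Lemma convex_set_segment (R : realType) (V : lmodType R) (U : set V)
    (x y : V) (t : R) :
  convex_set U -> U x -> U y -> 0 <= t <= 1 -> U (y + t *: (x - y)).
Proof.
move=> cU Ux Uy /andP[t0 t1].
have /= := cU x y (Itv01 t0 t1) (mem_set Ux) (mem_set Uy).
rewrite inE; congr U.
rewrite /conv/= scalerBl scale1r scalerBr.
by rewrite addrCA.
Qed.

Lemma enorm_mean_value (R : realType) (d : nat) (U : set 'cV[R]_d)
    (g : 'cV[R]_d -> 'cV[R]_d) (Dg : 'cV[R]_d -> 'M[R]_d) (k : R) :
  convex_set U ->
  (forall x v i, U x -> is_derive x v (fun y => g y i 0) ((Dg x *m v) i 0)) ->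
  (forall x v, U x -> enorm (Dg x *m v) <= k * enorm v) ->
  forall x y, U x -> U y -> enorm (g x - g y) <= k * enorm (x - y).
Proof.
move=> cU dg Dgk x y Ux Uy.
set w := g x - g y; set v := x - y.
(* The main argument divides by [enorm w]. When it vanishes, the right-hand side is nonnegative
   because it bounds a norm; no sign of [k] is assumed. *)
have [w0|w0] := eqVneq (enorm w) 0.
  by rewrite w0; apply: le_trans (Dgk _ _ Ux); exact: enorm_ge0.
(* Pairing with the increment w itself reduces the vector-valued estimate to
   the scalar mean value theorem. *)
pose phi (s : R) := edot w (g (y + s *: v)).
have Useg (t : R) : t \in `[0, 1] -> U (y + t *: v).
  by rewrite in_itv/= => t01; exact: convex_set_segment.
have dphi (t : R) : t \in `[0, 1] ->
    is_derive t 1 phi (edot w (Dg (y + t *: v) *m v)).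
  move=> t01.
  (* As a sum of scaled functions, [phi] matches the differentiation rules for sums and scalings. *)
  have -> : phi = \sum_(i < d) (w i 0 \*: (fun s => g (y + s *: v) i 0)).
    by apply/funext => s; rewrite fct_sumE.
  apply: is_derive_sum => i; apply: is_deriveZ.
  exact: (is_derive_line (V := 'cV[R]_d) (h := fun z => g z i 0)
    (dg (y + t *: v) v i (Useg t t01))).
have cphi : {within `[0, 1], continuous phi}.
  by apply: derivable_within_continuous => t /dphi[].
have dphi_oo (t : R) : t \in `]0, 1[ ->
    is_derive t 1 phi (edot w (Dg (y + t *: v) *m v)).
  by move/subset_itv_oo_cc; exact: dphi.
(* This gives [enorm w ^+ 2 = edot w (Dg (y + t *: v) *m v)] for some [t]; Cauchy-Schwarz and
   division by [enorm w] conclude. *)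
have [t t01] := MVT_segment ler01 dphi_oo cphi.
have -> : phi 1 - phi 0 = enorm w ^+ 2.
  rewrite enorm_sqr_edot /phi /edot -sumrB; apply: eq_bigr => i _.
  by rewrite scale1r scale0r addr0 [y + v]subrKC -mulrBr !mxE.
rewrite subr0 mulr1 => wE.
have w_gt0 : 0 < enorm w by rewrite lt_def w0 enorm_ge0.
rewrite -(ler_pM2l w_gt0) -expr2 wE (le_trans (edot_le _ _))//.
by rewrite ler_pM2l// Dgk//; exact: Useg.
Qed.

Unset Implicit Arguments.
Set Strict Implicit.

Theorem theorem2p3 (R : realType) (d : nat) (hd : (0 < d)%N)
    (U : set 'cV[R]_d) (openU : open U) (convexU : convex_set U)
    (f : 'cV[R]_d -> 'cV[R]_d) (C1f : C1_on U f)
    (xn : 'cV[R]_d) (Uxn : U xn)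
    (M : 'cV[R]_d -> 'M[R]_d) (unitM : M xn \in unitmx)
    (alpha omega kappa : R)
    (alphaE : alpha = enorm (invmx (M xn) *m f xn))
    (omega_gt0 : 0 < omega) (kappa_lt1 : kappa < 1)
    (A1 : forall (x v : 'cV[R]_d) (t : R), U x -> U v -> 0 <= t <= 1 ->
       let z := t *: x + (1 - t) *: v in
       enorm (invmx (M xn) *m (Jac f x - Jac f z) *m (x - v))
         <= omega * (1 - t) * enorm (x - v) ^+ 2)
    (A2 : forall x : 'cV[R]_d, U x ->
       opnorm (1%:M - invmx (M xn) *m Jac f x) <= kappa)
    (A3 : 0 < alpha /\ omega * alpha <= (1 - kappa) ^+ 2 / 2)
    (Rstar : R)
    (RstarE : Rstar = (1 - kappa) / omega
       + Num.sqrt ((1 - kappa) ^+ 2 / omega ^+ 2 - 2 * alpha / omega))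
    (A4 : eball xn Rstar `<=` U) :
  let g (v : 'cV[R]_d) := v - invmx (M xn) *m f v in
  g @` eball xn Rstar `<=` eball xn Rstar
  /\ econtraction_on (eball xn Rstar) g.
Proof.
move=> g.
have [df _] := C1f.
have g_lip x y : U x -> U y -> enorm (g x - g y) <= kappa * enorm (x - y).
  apply: (enorm_mean_value (Dg := fun z => 1%:M - invmx (M xn) *m Jac f z))
    => // {x y} x v.
  - move=> i Ux.
    (* The matrix product is unfolded into a linear combination of the coordinates of [f], each of
       which has a known directional derivative. *)
    have -> : (fun y => g y i 0) = (fun y : 'cV[R]_d => y i 0) -
        \sum_(j < d) (invmx (M xn) i j \*: (fun y => f y j 0)).
      by apply/funext => y; rewrite fctE /= fct_sumE !mxE.
    have -> : ((1%:M - invmx (M xn) *m Jac f x) *m v) i 0 =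
        v i 0 - \sum_(j < d) invmx (M xn) i j *: (Jac f x *m v) j 0.
      by rewrite mulmxBl mul1mx -mulmxA !mxE.
    apply: is_deriveB.
      apply: DeriveDef.
        exact/diff_derivable/differentiable_coord.
      have := derive_mx (@derivable_id _ _ x v).
      by rewrite derive_id => /colP/(_ i) ->; rewrite mxE.
    apply: is_derive_sum => j; apply: is_deriveZ.
    by apply: is_derive_coord_Jac; apply: df; rewrite inE.
  - move=> Ux; apply: le_trans (enorm_mulmx_le _ _) _.
    by rewrite ler_wpM2r ?enorm_ge0// A2.
split; last first.
  by exists kappa => // x y /set_mem /A4 Ux /set_mem /A4 Uy; exact: g_lip.
have [alpha_gt0 A3'] := A3.
have omega_neq0 : omega != 0 by rewrite gt_eqF.
have disc_ge0 : 0 <= (1 - kappa) ^+ 2 / omega ^+ 2 - 2 * alpha / omega.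
  (* Up to the positive factor [2 / omega ^+ 2], the radicand is the slack in (A*3). *)
  have -> : (1 - kappa) ^+ 2 / omega ^+ 2 - 2 * alpha / omega =
      ((1 - kappa) ^+ 2 / 2 - omega * alpha) * 2 / omega ^+ 2 by field.
  by rewrite divr_ge0 ?sqr_ge0// mulr_ge0// subr_ge0.
have RstarQ : alpha + omega / 2 * Rstar ^+ 2 = (1 - kappa) * Rstar.
  have := sqr_sqrtr disc_ge0; rewrite RstarE.
  set s := Num.sqrt _ => s2.
  have -> : ((1 - kappa) / omega + s) ^+ 2 = (1 - kappa) ^+ 2 / omega ^+ 2
    + 2 * (1 - kappa) / omega * s + s ^+ 2 by field.
  by rewrite s2; field.
(* The sign of [kappa] comes from (A*2) at [xn]; it is what allows multiplying
   [enorm (x - xn) <= Rstar] by [kappa] below. *)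
have kappa_ge0 : 0 <= kappa.
  exact: le_trans (opnorm_ge0 _) (A2 _ Uxn).
move=> _ [x xR <-]; rewrite /eball/=.
have -> : g x - xn = (g x - g xn) + (g xn - xn) by rewrite addrA subrK.
have alphaE' : enorm (g xn - xn) = alpha.
  by rewrite /g addrAC subrr add0r -scaleN1r enormZ normrN1 mul1r.
apply: le_trans (enormD _ _) _; rewrite alphaE'.
have := g_lip _ _ (A4 _ xR) Uxn.
have xR' : enorm (x - xn) <= Rstar := xR.
have : kappa * enorm (x - xn) <= kappa * Rstar by rewrite ler_wpM2l.
(* Dropping this term from [RstarQ] leaves [alpha + kappa * Rstar <= Rstar], which closes the
   triangle inequality through [g xn]. *)
have : 0 <= omega / 2 * Rstar ^+ 2 by rewrite mulr_ge0 ?sqr_ge0 ?divr_ge0 ?ltW.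
lra.
Qed.
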